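(* Let $n\geq 2$. The network realignment graph $\mathcal G_n$ is bipartite if and only if $n$ is even.
   Context: The network realignment graph $\mathcal G_n$ has as vertices all labelled trees on the vertex set $[n]=\{1,\dots,n\}$ (spanning trees of $K_n$). Two trees are adjacent if they differ by a single leaf slide: $T_2$ is obtained from $T_1$ by choosing a leaf $v$ of $T_1$ with neighbour $u$ and a neighbour $w\ne v$ of $u$ in $T_1$, deleting the edge $(v,u)$ and inserting the edge $(v,w)$. *)

(* Defs.v *)
From mathcomp Require Import all_boot.

Set Implicit Arguments.
Unset Strict Implicit.
Unset Printing Implicit Defensive.

(* A graph on [n] is given by its edge set, a set of two-element subsets of
   'I_n. *)
Section EdgeSets.
Variable n : nat.
Implicit Types (T : {set {set 'I_n}}) (u v w : 'I_n).

Definition adj T : rel 'I_n := [rel u v | [set u; v] \in T].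

Definition simple_edges T := [forall e in T, #|e| == 2].

Definition connected T := [forall u, forall v, connect (adj T) u v].

(* A cycle has pairwise distinct vertices, so its length is at most n; the
   bound on k only serves to make the quantification finite. *)
Definition acyclic T :=
  [forall k : 'I_n.+1, forall s : k.-tuple 'I_n,
     (2 < k) ==> ~~ ucycleb (adj T) s].

Definition is_tree T := [&& simple_edges T, connected T & acyclic T].

Definition leaf T v := #|[set u | adj T v u]| == 1.

Definition slide T v u w := [set v; w] |: (T :\ [set v; u]).

End EdgeSets.

Definition labelled_tree n := {T : {set {set 'I_n}} | is_tree T}.

Definition realignment n : rel (labelled_tree n) :=
  [rel T1 T2 |
    [exists v, exists u, exists w,
      [&& leaf (val T1) v, adj (val T1) v u, adj (val T1) u w, w != v
        & val T2 == slide (val T1) v u w]]].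

Definition bipartite (V : finType) (e : rel V) :=
  exists A : {set V}, forall x y, e x y -> (x \in A) != (y \in A).

Lemma realignmentP n (T1 T2 : labelled_tree n) :
  reflect (exists v u w, [/\ leaf (val T1) v, adj (val T1) v u,
             adj (val T1) u w, w != v & val T2 = slide (val T1) v u w])
          (realignment T1 T2).
Proof.
apply: (iffP existsP) => [[v /existsP[u /existsP[w]]]|[v [u [w [*]]]]].
  by case/and5P=> *; exists v, u, w; split=> //; apply/eqP.
exists v; apply/existsP; exists u; apply/existsP; exists w.
by apply/and5P; split=> //; apply/eqP.
Qed.

Lemma adj_sym n (T : {set {set 'I_n}}) : symmetric (adj T).
Proof. by move=> u v; rewrite /adj /= setUC. Qed.

Lemma adj_neq n (T : labelled_tree n) u v : adj (val T) u v -> u != v.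
Proof.
have /and3P[/forall_inP sT _ _] := valP T.
by move=> /sT; rewrite cards2; case: (u != v).
Qed.

Lemma set2_inj n (v x y : 'I_n) : [set v; x] = [set v; y] -> x = y.
Proof.
move=> E; have := set22 v x; rewrite E !inE => /orP[/eqP xv|/eqP //].
by have := set22 v y; rewrite -E !inE xv orbb => /eqP.
Qed.

Lemma realignment_irr n : irreflexive (@realignment n).
Proof.
move=> T; case: realignmentP => // -[v [u [w [_ vu uw _ E]]]].
move: (vu); rewrite /adj /= E /slide !inE eqxx /= orbF => /eqP/set2_inj uE.
by have := adj_neq uw; rewrite uE eqxx.
Qed.

Lemma realignment_sym n : symmetric (@realignment n).
Proof.
suff S (T1 T2 : labelled_tree n) : realignment T1 T2 -> realignment T2 T1.
  by move=> T1 T2; apply/idP/idP => /S.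
case/realignmentP=> v [u [w [/cards1P[u' lv] vu uw wv E]]].
have Nv x : adj (val T1) v x = (x == u).
  have := in_set1 x u'; rewrite -lv inE => ->.
  by have := in_set1 u u'; rewrite -lv inE vu => /esym/eqP ->.
have nuw := adj_neq uw; have nvu := adj_neq vu.
have vwT1 : [set v; w] \notin val T1.
  by have := Nv w; rewrite /adj /= => ->; rewrite eq_sym.
apply/realignmentP; exists v, w, u; split.
- apply/cards1P; exists w; apply/setP => x; rewrite !inE /adj /= E !inE.
  have := Nv x; rewrite /adj /= => ->.
  have -> : ([set v; x] == [set v; w]) = (x == w).
    by apply/eqP/eqP => [/set2_inj|->].
  have -> : ([set v; x] == [set v; u]) = (x == u).
    by apply/eqP/eqP => [/set2_inj|->].
  by case: (x == u); rewrite ?andbF ?orbF.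
- by rewrite /adj /= E !inE eqxx.
- rewrite adj_sym /adj /= E !inE (uw : [set u; w] \in _) andbT.
  apply/orP; right; apply/eqP => E'; have := set21 v u.
  by rewrite -E' !inE (negPf nvu) eq_sym (negPf wv).
- by rewrite eq_sym.
- rewrite E /slide; apply/setP => e; rewrite !inE.
  case: (eqVneq e [set v; u]) => [->|_]; first exact: vu.
  by case: (eqVneq e [set v; w]) => [->|_]; first exact: negPf.
Qed.

(* Main.v *)
Require Import Defs.
From mathcomp Require Import all_boot.

(** The whole argument is a parity count, with a different object counted in
    each direction.

    When [n] is even, every tree has exactly two proper 2-colourings of its
    vertices, and their classes have sizes [a] and [n - a], which have the same
    parity; so the parity of a colour class depends on the tree alone.  Sliding
    a leaf from [u] to a neighbour [w] of [u] changes the colour of that leaf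
    and of nothing else, hence flips this parity: the parity itself is a
    2-colouring of the realignment graph.  The lemmas are [forest_bipartite]
    (a colouring exists), [coloring_parity] (the parity does not depend on it)
    and [coloring_slide].

    When [n] is odd, the star centred at [c] becomes the star centred at [w]
    after the [n - 2] leaves other than [w] have slid one by one from [c] to
    [w]; the trees in between are double stars with hubs [c] and [w].  As
    [n - 2] is odd, a 2-colouring of the realignment graph would give different
    colours to any two stars ([bipartite_star]), which is impossible since
    there are at least three of them. *)

(** * Two-colourings of trees *)

Lemma set2_eq {n} (a b x y : 'I_n) :
  ([set a; b] == [set x; y]) = ((a == x) && (b == y)) || ((a == y) && (b == x)).
Proof.
apply/eqP/orP => [E|[]/andP[/eqP-> /eqP->] //]; last by rewrite setUC.
have /set2P[ax|ay] : a \in [set x; y] by rewrite -E set21.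
  by left; move: E; rewrite ax eqxx => /set2_inj->; rewrite eqxx.
right; move: E; rewrite ay eqxx [[set x; y]]setUC.
by move=> /set2_inj->; rewrite eqxx.
Qed.

Lemma leaf_uniq {n} {T : {set {set 'I_n}}} {v x y : 'I_n} :
  leaf T v -> adj T v x -> adj T v y -> x = y.
Proof.
move=> /cards1P[u E] vx vy.
have : x \in [set u] by rewrite -E inE.
have : y \in [set u] by rewrite -E inE.
by rewrite !inE => /eqP-> /eqP->.
Qed.

Definition proper_coloring {n} (T : {set {set 'I_n}}) (A : {set 'I_n}) :=
  [forall x, forall y, adj T x y ==> ((x \in A) != (y \in A))].

Lemma proper_coloringP {n} (T : {set {set 'I_n}}) (A : {set 'I_n}) :
  reflect (forall x y, adj T x y -> (x \in A) != (y \in A))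
          (proper_coloring T A).
Proof.
apply: (iffP forallP) => [H x y xy|H x].
  by have /forallP/(_ y)/implyP := H x; apply.
by apply/forallP => y; apply/implyP; apply: H.
Qed.

Lemma acyclicP {n} (T : {set {set 'I_n}}) :
  reflect (forall s, 2 < size s -> ~~ ucycleb (adj T) s) (acyclic T).
Proof.
apply: (iffP forallP) => [H s s2|H k].
  apply/negP => cs; have /andP[_ us] := cs.
  have sn : size s < n.+1.
    by rewrite ltnS -(card_uniqP us) -[leqRHS]card_ord max_card.
  have /forallP/(_ (in_tuple s))/implyP := H (Ordinal sn).
  by move=> /(_ s2); rewrite cs.
by apply/forallP => s; apply/implyP => k2; apply: H; rewrite size_tuple.
Qed.

Lemma adj_subset {n} {T T' : {set {set 'I_n}}} :
  T \subset T' -> subrel (adj T) (adj T').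
Proof. by move=> /subsetP sTT' x y; apply: sTT'. Qed.

Lemma sub_acyclic {n} {T T' : {set {set 'I_n}}} :
  T \subset T' -> acyclic T' -> acyclic T.
Proof.
move=> sTT' /acyclicP aT'; apply/acyclicP => s /aT'.
apply: contra => /andP[cs us]; rewrite /ucycleb us andbT.
by apply: sub_cycle cs; apply: adj_subset.
Qed.

(** A simple path from [x] to [y] that does not use the edge [xy] would close
    up with that edge into a cycle. *)
Lemma acyclic_edge_bridge {n} {T : {set {set 'I_n}}} {x y : 'I_n} :
  acyclic T -> x != y -> adj T x y ->
  ~~ connect (adj (T :\ [set x; y])) x y.
Proof.
move=> /acyclicP aT nxy xy; apply/negP => /connectP[p0 p0P].
case/shortenP: p0P => p pP up _ yE.
case: p pP up yE => [|z [|t q]] pP up yE; first by rewrite yE eqxx in nxy.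
  by move: pP; rewrite yE /= /adj /= !inE eqxx.
have /aT/negP[] : 2 < size [:: x, z, t & q] by [].
rewrite /ucycleb up andbT (cycle_path x) /= -[last _ _]yE adj_sym xy /=.
by apply: sub_path pP; apply: adj_subset; apply: subsetDl.
Qed.

(** Induction on the edges: an edge whose ends received the same colour from
    the rest of the forest joins two components of that rest, so all colours
    can be swapped on one of these two components. *)
Lemma forest_bipartite {n} (T : {set {set 'I_n}}) :
  simple_edges T -> acyclic T -> exists A, proper_coloring T A.
Proof.
have [m] := ubnP #|T|; elim: m T => // m IH T; rewrite ltnS => Tm sT aT.
have [->|[e eT]] := set_0Vmem T.
  by exists set0; apply/proper_coloringP => x y; rewrite /adj /= inE.
have /cards2P[x [y [nxy De]]] : #|e| == 2 by apply: (forall_inP sT).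
have xy : adj T x y by rewrite /adj /= -De.
pose T' := T :\ e; have sTT' : T' \subset T by apply: subsetDl.
have {IH} [||| A /proper_coloringP cA] := IH T'.
- by apply: leq_trans Tm; rewrite [leqRHS](cardsD1 e) eT.
- by apply/forall_inP => f /(subsetP sTT'); apply: (forall_inP sT).
- exact: sub_acyclic aT.
suff [B /proper_coloringP cB nB] :
    exists2 B, proper_coloring T' B & (x \in B) != (y \in B).
  exists B; apply/proper_coloringP => z t zt.
  have [/eqP|nE] := eqVneq [set z; t] e; last first.
    by apply: cB; rewrite /adj /= /T' !inE nE.
  rewrite De set2_eq => /orP[]/andP[/eqP-> /eqP->] //.
  by rewrite eq_sym.
have [eqA|neqA] := eqVneq (x \in A) (y \in A); last first.
  by exists A => //; apply/proper_coloringP.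
pose C := connect (adj T') x.
exists [set z | (z \in A) (+) C z]; last first.
  have /negPf Cy : ~~ C y by rewrite /C /T' De acyclic_edge_bridge.
  by rewrite !inE Cy /C connect0 eqA; case: (_ \in _).
apply/proper_coloringP => z t zt; rewrite !inE.
have -> : C t = C z.
  rewrite /C; apply/idP/idP => Cz; apply: (connect_trans Cz);
    by apply: connect1 => //; rewrite adj_sym.
by have := cA _ _ zt; case: (z \in A); case: (t \in A); case: (C z).
Qed.

(** Two proper colourings of a connected graph agree everywhere or nowhere,
    since whether they agree is preserved along edges. *)
Lemma coloring_parity {n} {T : {set {set 'I_n}}} {A B : {set 'I_n}} :
  ~~ odd n -> connected T -> proper_coloring T A -> proper_coloring T B ->
  odd #|A| = odd #|B|.
Proof.
move=> en cT /proper_coloringP cA /proper_coloringP cB.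
have agree x y : ((x \in A) (+) (x \in B)) = ((y \in A) (+) (y \in B)).
  have /forallP/(_ x)/forallP/(_ y)/connectP[p pP ->] := cT.
  elim: p x pP => //= z p IH x /andP[xz /IH IHz].
  rewrite -IHz; have := cA _ _ xz; have := cB _ _ xz.
  by case: (x \in A); case: (z \in A); case: (x \in B); case: (z \in B).
have [E|[x]] := set_0Vmem [set x | (x \in A) (+) (x \in B)]; last first.
  rewrite inE => xAB; have -> : B = ~: A.
    apply/setP => y; move: xAB; rewrite (agree x y) !inE.
    by case: (y \in A); case: (y \in B).
  have /(congr1 odd) := cardsC A; rewrite card_ord oddD (negPf en).
  by do 2!case: (odd _).
suff -> : A = B by [].
apply/setP => y; have /setP/(_ y) := E.
by rewrite !inE; case: (y \in A); case: (y \in B).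
Qed.

(** The vertex [u] is adjacent to both [v] and [w], so the leaf [v] and its
    future neighbour [w] have the same colour before the slide: recolouring [v]
    alone repairs the colouring. *)
Lemma coloring_slide {n} {T : {set {set 'I_n}}} {A : {set 'I_n}} {v u w} :
  leaf T v -> adj T v u -> adj T u w -> w != v -> proper_coloring T A ->
  exists2 B, proper_coloring (slide T v u w) B & odd #|B| != odd #|A|.
Proof.
move=> lv vu uw nwv /proper_coloringP cA.
have Avw : (v \in A) = (w \in A).
  have := cA _ _ vu; have := cA _ _ uw.
  by case: (v \in A); case: (u \in A); case: (w \in A).
exists [set z | (z \in A) (+) (z == v)].
  have off_v x y : adj T x y -> [set x; y] != [set v; u] -> x != v.
    move=> xy nE; apply/eqP => xv; move: nE xy; rewrite xv => nE vy.
    by rewrite (leaf_uniq lv vy vu) eqxx in nE.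
  apply/proper_coloringP => x y; rewrite /adj /= !inE => /orP[|/andP[nE xy]].
    rewrite set2_eq => /orP[]/andP[/eqP-> /eqP->];
    by rewrite Avw eqxx (negPf nwv); case: (w \in A).
  have xv : x != v by exact: off_v xy nE.
  have yv : y != v by apply: (off_v y x); [rewrite adj_sym | rewrite setUC].
  rewrite (negPf xv) (negPf yv) !addbF; exact: cA.
have [vA|vA] := boolP (v \in A).
  have -> : [set z | (z \in A) (+) (z == v)] = A :\ v.
    by apply/setP => z; rewrite !inE; case: eqP => [->|_]; rewrite ?vA ?addbF.
  by rewrite (cardsD1 v A) vA /=; case: (odd _).
have -> : [set z | (z \in A) (+) (z == v)] = v |: A.
  apply/setP => z; rewrite !inE; case: eqP => [->|_]; last by rewrite addbF.
  by rewrite (negPf vA).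
by rewrite cardsU1 vA /=; case: (odd _).
Qed.

(** * Even order: the parity of a colour class *)

Lemma even_bipartite {n} : ~~ odd n -> bipartite (@realignment n).
Proof.
move=> en.
pose odd_class (T : {set {set 'I_n}}) :=
  [exists A : {set 'I_n}, proper_coloring T A && odd #|A|].
have odd_classE (T : {set {set 'I_n}}) A :
    is_tree T -> proper_coloring T A -> odd_class T = odd #|A|.
  case/and3P=> _ cT _ cA; apply/existsP/idP => [[B /andP[cB]]|oA].
    by rewrite (coloring_parity en cT cA cB).
  by exists A; rewrite cA.
exists [set T | odd_class (val T)] => T1 T2 /realignmentP.
move=> [v [u [w [lv vu uw wv E]]]]; rewrite !inE.
have tT1 := valP T1; have /and3P[sT _ aT] := tT1.
have [A cA] := forest_bipartite _ sT aT.
have [B cB nAB] := coloring_slide lv vu uw wv cA.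
rewrite (odd_classE _ A) // (odd_classE _ B) ?E // -?E; last exact: valP.
by rewrite eq_sym.
Qed.

(** * Double stars *)

Definition star {n} (c : 'I_n) : {set {set 'I_n}} :=
  [set [set x; c] | x in ~: [set c]].

Definition hub {n} (c w : 'I_n) (S : {set 'I_n}) x := if x \in S then w else c.

(** As soon as [S] avoids [w], the hub of [w] is [c], so that indexing the edges
    by the vertices other than [c] also yields the edge between the hubs. *)
Definition double_star {n} (c w : 'I_n) (S : {set 'I_n}) : {set {set 'I_n}} :=
  [set [set x; hub c w S x] | x in ~: [set c]].

Lemma double_star0 {n} (c w : 'I_n) : double_star c w set0 = star c.
Proof. by apply: eq_imset => x; rewrite /hub inE. Qed.

Lemma double_starC {n} (c w : 'I_n) :
  c != w -> double_star c w (~: [set c; w]) = star w.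
Proof.
(* The edge [wc] comes from [w] on the left and from [c] on the right, so the
   edge sets are compared and not the two indexings. *)
move=> ncw; have hub_c x : x != c -> x != w -> hub c w (~: [set c; w]) x = w.
  by move=> xc xw; rewrite /hub !inE (negPf xc) (negPf xw).
have hub_w : hub c w (~: [set c; w]) w = c.
  by rewrite /hub !inE eqxx orbT.
apply/setP => e; apply/imsetP/imsetP => -[x]; rewrite !inE => nx ->.
  have [->|xw] := eqVneq x w; last by exists x; rewrite ?inE // hub_c.
  by exists c; rewrite ?inE // hub_w setUC.
have [->|xc] := eqVneq x c; last by exists x; rewrite ?inE // hub_c.
by exists w; rewrite ?inE 1?eq_sym // hub_w setUC.
Qed.

Lemma adj_double_star {n} (c w : 'I_n) (S : {set 'I_n}) (x y : 'I_n) :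
  adj (double_star c w S) x y =
  (x != c) && (y == hub c w S x) || (y != c) && (x == hub c w S y).
Proof.
apply/imsetP/orP => [[z]|[]/andP[zc /eqP->]].
- rewrite !inE => zc /eqP; rewrite set2_eq.
  by case/orP=> /andP[/eqP-> /eqP->]; rewrite zc eqxx; [left|right].
- by exists x; rewrite ?inE.
- by exists y; rewrite ?inE // setUC.
Qed.

(** Each vertex of a cycle has two distinct neighbours, its predecessor and its
    successor. *)
Lemma leaf_notin_cycle {n} (T : {set {set 'I_n}}) (x : 'I_n) s :
  leaf T x -> 2 < size s -> ucycleb (adj T) s -> x \notin s.
Proof.
move=> lx s2 /andP[cs us]; apply/negP => /rot_to[i s' E].
move: s2 cs us; rewrite -(size_rot i) -(rot_cycle i) -(rot_uniq i) E.
case: s' {E} => [|y s'] //; case/lastP: s' => [|s' z] //= _.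
rewrite rcons_path last_rcons => /and3P[xy _ zx] /and3P[_ + _].
by rewrite (leaf_uniq lx xy (_ : adj T x z)) ?mem_rcons ?mem_head // adj_sym.
Qed.

Lemma leaf_double_star {n} (c w : 'I_n) (S : {set 'I_n}) (x : 'I_n) :
  x != c -> x != w -> leaf (double_star c w S) x.
Proof.
move=> xc xw; apply/cards1P; exists (hub c w S x).
apply/setP => y; rewrite !inE adj_double_star xc /=.
rewrite [X in _ || _ && X](_ : _ = false) ?andbF ?orbF //.
by rewrite /hub; case: ifP; rewrite ?(negPf xc) ?(negPf xw).
Qed.

(** All vertices but the two hubs are leaves, hence lie on no cycle: a cycle
    would have at most two vertices. *)
Lemma double_star_tree {n} (c w : 'I_n) (S : {set 'I_n}) :
  c != w -> S \subset ~: [set c; w] -> is_tree (double_star c w S).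
Proof.
move=> ncw sS.
have hubE x : hub c w S x = c \/ hub c w S x = w.
  by rewrite /hub; case: ifP; [right|left].
have nhub x : x != c -> x != hub c w S x.
  rewrite /hub; case: ifP => // xS _.
  by have := subsetP sS x xS; rewrite !inE negb_or => /andP[].
have hubw : hub c w S w = c.
  by rewrite /hub; case: ifP => // /(subsetP sS); rewrite !inE eqxx orbT.
apply/and3P; split.
- apply/forall_inP => e /imsetP[x]; rewrite !inE => xc ->.
  by rewrite cards2 nhub.
- have sC : connect_sym (adj (double_star c w S)).
    by apply: sym_connect_sym; apply: adj_sym.
  have wc : connect (adj (double_star c w S)) w c.
    by apply: connect1; rewrite adj_double_star hubw eq_sym ncw eqxx.
  have to_c x : connect (adj (double_star c w S)) x c.
    have [->|xc] := eqVneq x c; first exact: connect0.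
    have xh : connect (adj (double_star c w S)) x (hub c w S x).
      by apply: connect1; rewrite adj_double_star xc eqxx.
    by apply: connect_trans xh _; have [->|->] := hubE x.
  apply/forallP => x; apply/forallP => y.
  by apply: connect_trans (to_c x) _; rewrite sC.
- apply/acyclicP => s s2; apply/negP => cs; have /andP[_ us] := cs.
  have : size s <= 2.
    rewrite -(card_uniqP us); apply: (@leq_trans #|[set c; w]|); last first.
      by rewrite cards2; case: (_ != _).
    apply/subset_leq_card/subsetP => x xs; rewrite !inE; apply: contraLR xs.
    rewrite negb_or => /andP[xc xw].
    by apply: leaf_notin_cycle s2 cs; apply: leaf_double_star.
  by rewrite leqNgt s2.
Qed.

Lemma double_star_slide {n} (c w : 'I_n) (S : {set 'I_n}) (x : 'I_n) :
  c != w -> x \notin S -> x |: S \subset ~: [set c; w] ->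
  double_star c w (x |: S) = slide (double_star c w S) x c w.
Proof.
move=> ncw xS sS; have : x \in ~: [set c; w].
  by apply: (subsetP sS); rewrite !inE eqxx.
rewrite !inE negb_or => /andP[xc xw].
have split_x S' : double_star c w S' = [set x; hub c w S' x] |:
    [set [set y; hub c w S' y] | y in ~: [set c] :\ x].
  by rewrite /double_star -[~: [set c] in LHS](@setD1K _ x) ?imsetU1 // !inE.
rewrite /slide [in LHS]split_x [in RHS]split_x.
have -> : hub c w (x |: S) x = w by rewrite /hub !inE eqxx.
have -> : hub c w S x = c by rewrite /hub (negPf xS).
rewrite setU1K.
  congr (_ |: _); apply: eq_in_imset => y; rewrite !inE => /andP[yx _].
  by rewrite /hub !inE (negPf yx).
apply/imsetP => -[y]; rewrite !inE => /andP[yx _] /eqP.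
rewrite set2_eq eq_sym (negPf yx) /= => /andP[].
by rewrite /hub; case: ifP; rewrite ?(negPf xc) ?(negPf xw).
Qed.

(** * Odd order: sliding from one star to another *)

(** Membership of a bare edge set in a set of trees: it avoids carrying the
    proofs that the double stars are trees. *)
Definition tree_in {n} (A : {set labelled_tree n}) (T : {set {set 'I_n}}) :=
  T \in [set val T1 | T1 in A].

Lemma tree_in_slide {n} {A : {set labelled_tree n}} {T v u w} :
  (forall T1 T2, realignment T1 T2 -> (T1 \in A) != (T2 \in A)) ->
  is_tree T -> is_tree (slide T v u w) ->
  leaf T v -> adj T v u -> adj T u w -> w != v ->
  tree_in A (slide T v u w) = ~~ tree_in A T.
Proof.
move=> colA tT tT' lv vu uw wv.
have inA (T1 : labelled_tree n) : tree_in A (val T1) = (T1 \in A).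
  by rewrite /tree_in mem_imset //; apply: val_inj.
pose T1 : labelled_tree n := Sub T tT.
pose T2 : labelled_tree n := Sub (slide T v u w) tT'.
have /colA : realignment T1 T2 by apply/realignmentP; exists v, u, w.
by rewrite -!inA /=; do 2!case: (tree_in A _).
Qed.

(** The leaves of [S] slide from [c] to [w] one at a time, each slide changing
    the colour. *)
Lemma tree_in_double_star {n} {A : {set labelled_tree n}} {c w : 'I_n}
    {S : {set 'I_n}} :
  (forall T1 T2, realignment T1 T2 -> (T1 \in A) != (T2 \in A)) ->
  c != w -> S \subset ~: [set c; w] ->
  tree_in A (double_star c w S) = tree_in A (star c) (+) odd #|S|.
Proof.
move=> colA ncw.
have [m] := ubnP #|S|; elim: m S => // m IH S; rewrite ltnS => Sm.
have [->|[x xS]] := set_0Vmem S; first by rewrite double_star0 cards0 addbF.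
move: Sm; rewrite (cardsD1 x) xS => Sm sS.
have sS' : S :\ x \subset ~: [set c; w].
  by apply: subset_trans sS; apply: subsetDl.
have := subsetP sS x xS; rewrite !inE negb_or => /andP[xc xw].
have xS' : x \notin S :\ x by rewrite !inE eqxx.
have hw : (w \in S :\ x) = false.
  by apply/negP => /(subsetP sS'); rewrite !inE eqxx orbT.
have E : double_star c w S = slide (double_star c w (S :\ x)) x c w.
  by rewrite -double_star_slide ?setD1K.
rewrite E tree_in_slide -?E //.
- by rewrite IH //= addbN.
- exact: double_star_tree.
- exact: double_star_tree.
- exact: leaf_double_star.
- by rewrite adj_double_star xc /hub (negPf xS') eqxx.
- by rewrite adj_double_star /hub hw (eq_sym w c) ncw !eqxx orbT.
- by rewrite eq_sym.
Qed.

Lemma bipartite_star {n} {A : {set labelled_tree n}} {c w : 'I_n} :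
  (forall T1 T2, realignment T1 T2 -> (T1 \in A) != (T2 \in A)) ->
  odd n -> c != w -> tree_in A (star w) = ~~ tree_in A (star c).
Proof.
move=> colA on ncw; rewrite -(double_starC c w ncw) tree_in_double_star //.
have /(congr1 odd) := cardsC [set c; w].
by rewrite card_ord cards2 ncw oddD on /= => ->; rewrite addbT.
Qed.

Lemma odd_not_bipartite {n} : 1 < n -> odd n -> ~ bipartite (@realignment n).
Proof.
case: n => [|[|[|n]]] // _ on [A colA].
pose i0 := @Ordinal n.+3 0 isT; pose i1 := @Ordinal n.+3 1 isT.
pose i2 := @Ordinal n.+3 2 isT.
have e01 := bipartite_star colA on (isT : i0 != i1).
have e12 := bipartite_star colA on (isT : i1 != i2).
have := bipartite_star colA on (isT : i0 != i2).
by rewrite e12 e01; case: (tree_in _ _).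
Qed.

Theorem proposition3p8 (n : nat) (hn : 2 <= n) :
  bipartite (@realignment n) <-> ~~ odd n.
Proof.
split; last exact: even_bipartite.
by move=> bn; apply/negP => on; apply: odd_not_bipartite bn.
Qed.
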